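(* (i) Let $k$ be a field of characteristic $3$. Every simply ramified separable rational function defined over $\overline{k}$ with only $k$-rational ramification points is equivalent to a rational function defined over $k$. (ii) Let $k$ be a finite field of characteristic greater than $3$. There exists a simply ramified separable rational function of degree $3$ defined over $\overline{k}$, with only $k$-rational ramification points, which is not equivalent to a rational function defined over $k$. (iii) Let $k$ be a non-algebraically closed field of characteristic $2$. Suppose that $f(x)$ is a separable rational function of degree $d>1$ defined over $\overline{k}$ with only $k$-rational ramification points. Then there are infinitely many equivalence classes of separable degree $d$ rational functions (defined over $\overline{k}$) with the same Wronskian as $f(x)$ which are not equivalent to a rational function defined over $k$. The same conclusion holds if $k$ is a non-algebraically closed field of characteristic $3$ and $f(x)$ is a separable degree $d$ rational function defined over $\overline{k}$ with only $k$-rational ramification points which is not simply ramified.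
   Context: Let $k$ be a field with algebraic closure $\overline{k}$. A rational function defined over $\overline{k}$ (resp. over $k$) is $f(x)=g(x)/h(x)$ with $g,h$ coprime polynomials in $\overline{k}[x]$ (resp. $k[x]$); its degree is $d=\max(\deg g,\deg h)$, and it is regarded as a morphism $\mathbb{P}^1_{\overline{k}}\to\mathbb{P}^1_{\overline{k}}$. All rational functions are assumed separable, i.e. $f$ is nonconstant and the induced extension of function fields is separable (equivalently, $f'(x)\neq 0$). Two rational functions $f_1,f_2$ over $\overline{k}$ are equivalent if there is a fractional linear transformation $\sigma$ over $\overline{k}$ with $f_2=\sigma\circ f_1$. The ramification points of $f$ are the points of $\mathbb{P}^1(\overline{k})$ (possibly including $\infty$) where the ramification index of $f$ is at least $2$; such a point is $k$-rational if it lies in $\mathbb{P}^1(k)=k\cup\{\infty\}$. The function $f$ is simply ramified if none of its ramification indices is greater than $2$. The Wronskian of $f=g/h$ is the polynomial $Wr(f)=h(x)g'(x)-g(x)h'(x)$. It has degree at most $2d-2$, and for an equivalence class of rational functions it is defined up to multiplication by a nonzero constant; two functions of the same degree have the same Wronskian if their Wronskians agree up to a nonzero constant in $\overline{k}$. *)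

(* Defs.v *)
From HB Require Import structures.
From mathcomp Require Import all_boot all_order all_algebra.
From mathcomp Require Import boolp classical_sets functions cardinality.

Set Implicit Arguments.
Unset Strict Implicit.
Unset Printing Implicit Defensive.

Import GRing.Theory.
Local Open Scope ring_scope.

(* The pair (num, den) representing a rational function is only unique up to
   a common nonzero scalar. No notion below depends on this choice; the
   Wronskian is only ever compared up to a nonzero constant. *)
Record ratfun (F : fieldType) := RatFun {
  num : {poly F};
  den : {poly F};
  den_neq0 : den != 0;
  num_den_coprime : coprimep num den
}.

Section RationalFunctions.

Variable F : fieldType.
Implicit Types f : ratfun F.

Definition degree f : nat := maxn (size (num f)).-1 (size (den f)).-1.

Definition wronskian f : {poly F} :=
  den f * (num f)^`() - num f * (den f)^`().

Definition ratfun_deriv f : {fraction {poly F}} :=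
  tofrac (wronskian f) / tofrac (den f ^+ 2).

(* f' != 0 forces f to be nonconstant and is equivalent to separability of the
   extension of function fields F(x)/F(f). *)
Definition separable f : Prop := ratfun_deriv f != 0.

(* Multiplicity of x as a root of h(x) * g - g(x) * h, for g and h coprime.
   If h(x) != 0 this is the order of vanishing of g/h - (g/h)(x) at x; if
   h(x) = 0 then g(x) != 0 and this is the order of the pole of g/h at x. *)
Definition ram_index_at (g h : {poly F}) (x : F) : nat :=
  mup x (h.[x] *: g - g.[x] *: h).

(* The polynomial 'X^d * p(1 / 'X), for p of degree at most d. *)
Definition reverse (d : nat) (p : {poly F}) : {poly F} :=
  \poly_(i < d.+1) p`_(d - i).

(* Points of P^1(F) are elements of option F, None being the point at
   infinity. The index of f at infinity is that of f(1/x) at 0. *)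
Definition ram_index f (P : option F) : nat :=
  match P with
  | Some x => ram_index_at (num f) (den f) x
  | None => ram_index_at (reverse (degree f) (num f))
                         (reverse (degree f) (den f)) 0
  end.

Definition ramified f (P : option F) : Prop := (2 <= ram_index f P)%N.

Definition simply_ramified f : Prop :=
  forall P : option F, (ram_index f P <= 2)%N.

(* f2 = (a f1 + b) / (c f1 + d) in F(x), cleared of denominators. The cleared
   identity fails when c f1 + d = 0, so it is equivalent to the original one:
   then a f1 + b != 0 as the determinant is nonzero, and den f2 != 0. *)
Definition equivalent f1 f2 : Prop :=
  exists a b c d : F, a * d - b * c != 0 /\
    num f2 * (c *: num f1 + d *: den f1) =
    den f2 * (a *: num f1 + b *: den f1).

Definition ratfun_class f : set (ratfun F) := [set f' | equivalent f f'].

Definition same_wronskian f1 f2 : Prop :=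
  degree f1 = degree f2 /\
  exists2 c : F, c != 0 & wronskian f2 = c *: wronskian f1.

End RationalFunctions.

Section BaseField.

Variables (k : fieldType) (K : closedFieldType) (iota : {rmorphism k -> K}).

Definition algebraic_closure : Prop := forall x : K, algebraicOver iota x.

Definition rational_point (P : option K) : Prop :=
  exists Q : option k, P = omap iota Q.

Definition rational_ramification (f : ratfun K) : Prop :=
  forall P : option K, ramified f P -> rational_point P.

Lemma map_den_neq0 (f : ratfun k) : map_poly iota (den f) != 0.
Proof. by rewrite map_poly_eq0 den_neq0. Qed.

Lemma map_num_den_coprime (f : ratfun k) :
  coprimep (map_poly iota (num f)) (map_poly iota (den f)).
Proof. by rewrite coprimep_map num_den_coprime. Qed.

Definition base_change (f : ratfun k) : ratfun K :=
  RatFun (map_den_neq0 f) (map_num_den_coprime f).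

Definition equiv_to_rational (f : ratfun K) : Prop :=
  exists f0 : ratfun k, equivalent f (base_change f0).

Definition infinitely_many_non_rational (f : ratfun K) : Prop :=
  infinite_set [set C : set (ratfun K) | exists f' : ratfun K,
    [/\ separable f', same_wronskian f f', ~ equiv_to_rational f'
      & C = ratfun_class f']].

End BaseField.

(* Main.v *)
Require Import Defs.
From HB Require Import structures.
From mathcomp Require Import all_boot all_order all_algebra.
From mathcomp Require Import boolp classical_sets functions cardinality.
From mathcomp Require Import ring zify.

(* A rational function g/h is studied, up to equivalence, through the pencil
   <g, h> of polynomials and its Wronskian W = h g' - g h'. At a point a, the
   member u of the pencil vanishing at a (at infinity: of smaller degree)
   vanishes to the order given by the ramification index.

   (i) In characteristic 3 every member y of the pencil satisfies (W y)'' = 0.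
   Simple ramification makes W squarefree of degree at least 2 d - 3, and then
   the pencil is the whole space of solutions y of degree at most d. As W is,
   up to a scalar, a polynomial over k, this is a linear system over k.

   (ii) The cubic x^2 (x + l c) / (c x + 1), with 3 + l c^2 + 2 c (1 + l) = 0,
   is ramified at 0, 1, l and infinity. Its pencil is defined over k only if c
   lies in k, which forces l^2 - l + 1 to be a square in k.

   (iii) If the index at a is at least p = char k, then u = v (x - a)^p (at
   infinity: v = u x^p), so u and v have zero Wronskian, and all the pencils
   <u, y + t v>, t in K, have the same Wronskian as <u, y>. They are pairwise
   distinct, and the t for which they are defined over k lie in a coset of a
   line over k in K. *)

Set Implicit Arguments.
Unset Strict Implicit.
Unset Printing Implicit Defensive.

Import GRing.Theory.
Local Open Scope ring_scope.

(** * Pencils, Wronskians and ramification *)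

Section Wronskian.

Variable F : fieldType.
Implicit Types (p q u v y : {poly F}) (f : ratfun F) (x a b c d s t : F).

Definition wr p q : {poly F} := p * q^`() - q * p^`().

Lemma wr_combr p q c d : wr p (c *: p + d *: q) = d *: wr p q.
Proof. by rewrite /wr !derivD !derivZ -!mul_polyC; ring. Qed.

Lemma wr_combl p q c d : wr (c *: q + d *: p) q = d *: wr p q.
Proof. by rewrite /wr !derivD !derivZ -!mul_polyC; ring. Qed.

Lemma wrZ p q a : wr p (a *: q) = a *: wr p q.
Proof. by rewrite /wr !derivZ -!mul_polyC; ring. Qed.

Lemma wrDl p q v : wr (p + q) v = wr p v + wr q v.
Proof. by rewrite /wr !derivD; ring. Qed.

Lemma wrZl p q a : wr (a *: p) q = a *: wr p q.
Proof. by rewrite /wr !derivZ -!mul_polyC; ring. Qed.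

Lemma wronskianE f : wronskian f = wr (den f) (num f).
Proof. by []. Qed.

Lemma separableE f : separable f <-> wr (den f) (num f) != 0.
Proof.
rewrite /separable /ratfun_deriv mulf_eq0 invr_eq0 !tofrac_eq0 negb_or.
rewrite expf_eq0 (negbTE (den_neq0 f)) andbF andbT.
by [].
Qed.

Lemma deriv_XsubC_exp x m :
  (('X - x%:P) ^+ m.+1)^`() = (m.+1%:R)%:P * ('X - x%:P) ^+ m.
Proof. by rewrite deriv_exp derivXsubC mul1r polyC_natr mulr_natl. Qed.

Lemma dvdp_wr x m y u :
  ('X - x%:P) ^+ m.+1 %| u -> ('X - x%:P) ^+ m %| wr y u.
Proof.
case/dvdpP=> q ->; rewrite /wr derivM deriv_XsubC_exp exprS.
move: (_%:R)%:P ('X - _) (_ ^+ m) => N L E.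
by apply/dvdpP; exists (y * (q^`() * L + q * N) - q * L * y^`()); ring.
Qed.

(** With [u = q L^(m+1)] and [L = X - x], the Wronskian is [(m+1) y q L^m] modulo [L^(m+1)]. As [y]
    and [m+1] do not vanish at [x], [L] must divide [q]. *)
Lemma dvdp_wr_lift x m y u : m.+1%:R != 0 :> F -> y.[x] != 0 ->
  ('X - x%:P) ^+ m.+1 %| u -> ('X - x%:P) ^+ m.+1 %| wr y u ->
  ('X - x%:P) ^+ m.+2 %| u.
Proof.
move=> m0 yx /dvdpP [q ->]; rewrite /wr derivM deriv_XsubC_exp => H.
rewrite exprS dvdp_mul2r ?expf_neq0 ?polyXsubC_eq0 // dvdp_XsubCl.
have: ('X - x%:P) ^+ m.+1 %| (m.+1%:R)%:P * y * q * ('X - x%:P) ^+ m.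
  move: H; rewrite !exprS.
  move: (_%:R)%:P ('X - _) (_ ^+ m) => N L E H.
  have -> : N * y * q * E =
    (y * (q^`() * (L * E) + q * (N * E)) - q * (L * E) * y^`())
    - (y * q^`() - q * y^`()) * (L * E) by ring.
  by rewrite dvdp_sub ?dvdp_mulIr.
rewrite exprS dvdp_mul2r ?expf_neq0 ?polyXsubC_eq0 // dvdp_XsubCl.
by rewrite !rootM rootC (negbTE m0) /= {1}/root (negbTE yx).
Qed.

(* A nonzero member of the pencil <g, h> killed by a linear form with values
   s, t at g, h, completed to a basis by whichever of g, h it does not kill. *)
Lemma pencil_basis (g h : {poly F}) s t : (s != 0) || (t != 0) ->
  exists y : {poly F}, exists2 c, c != 0 &
    [/\ y = h /\ c = t \/ y = g /\ c = s,
        wr y (t *: g - s *: h) = c *: wr h g,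
        exists e1 e2, g = e1 *: (t *: g - s *: h) + e2 *: y &
        exists e1 e2, h = e1 *: (t *: g - s *: h) + e2 *: y].
Proof.
have [t0|t0] := eqVneq t 0; last first.
  move=> _; exists h, t => //; split; first by left.
  - by rewrite /wr !derivB !derivZ -!mul_polyC; ring.
  - exists t^-1, (s / t); rewrite scalerBr !scalerA mulVf // scale1r.
    by rewrite [t^-1 * s]mulrC subrK.
  - by exists 0, 1; rewrite scale0r scale1r add0r.
rewrite orbF => s0; exists g, s => //; rewrite t0 scale0r sub0r.
split; first by right.
- by rewrite /wr derivN !derivZ -!mul_polyC; ring.
- by exists 0, 1; rewrite scale0r scale1r add0r.
- exists (- s^-1), 0; rewrite scale0r addr0 scalerN scaleNr opprK.
  by rewrite scalerA mulVf // scale1r.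
Qed.

Lemma coprimep_pencil (g h : {poly F}) s t y : coprimep g h ->
  y = h /\ t != 0 \/ y = g /\ s != 0 -> coprimep (t *: g - s *: h) y.
Proof.
move=> gh [[-> t0]|[-> s0]].
  rewrite addrC -scaleNr -mul_polyC coprimep_sym coprimep_addl_mul.
  by rewrite coprimep_sym coprimepZl.
rewrite -mul_polyC coprimep_sym coprimep_addl_mul -scaleNr.
by rewrite coprimepZr ?oppr_eq0.
Qed.

Lemma horner_coprime (g h : {poly F}) x : coprimep g h ->
  (g.[x] != 0) || (h.[x] != 0).
Proof.
move=> gh; have [/eqP g0|//] := eqVneq g.[x] 0.
by rewrite /= (coprimep_root gh).
Qed.

Lemma size_num f : (size (num f) <= (degree f).+1)%N.
Proof. by rewrite /degree; lia. Qed.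

Lemma size_den f : (size (den f) <= (degree f).+1)%N.
Proof. by rewrite /degree; lia. Qed.

Lemma degree_coef f :
  ((num f)`_(degree f) != 0) || ((den f)`_(degree f) != 0).
Proof.
have d0 := den_neq0 f; rewrite /degree.
have : (0 < size (den f))%N by rewrite size_poly_gt0.
have [le|lt] := leqP (size (num f)).-1 (size (den f)).-1 => _.
  by apply/orP; right; move: d0; rewrite -lead_coef_eq0.
apply/orP; left; rewrite -/(lead_coef _) lead_coef_eq0.
by apply: contraTneq lt => ->; rewrite size_poly0.
Qed.

Lemma degreeP f n : (size (num f) <= n.+1)%N -> (size (den f) <= n.+1)%N ->
  ((num f)`_n != 0) || ((den f)`_n != 0) -> degree f = n.
Proof.
move=> sn sd H; rewrite /degree; apply/eqP; rewrite eqn_leq; apply/andP; split.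
  by lia.
have E (p : {poly F}) : p`_n != 0 -> (n <= (size p).-1)%N.
  have [lt _|le] := ltnP n (size p); first by lia.
  by rewrite nth_default ?eqxx.
by case/orP: H => /E; lia.
Qed.

Lemma size_pencil p q n : (size p <= n.+1)%N -> (size q <= n.+1)%N ->
  (size (q`_n *: p - p`_n *: q)%R <= n)%N.
Proof.
move=> sp sq; apply/leq_sizeP=> j; rewrite leq_eqVlt => /orP [/eqP <-|lt].
  by rewrite coefB !coefZ mulrC subrr.
rewrite coefB !coefZ (nth_default _ (leq_trans sp lt)).
by rewrite (nth_default _ (leq_trans sq lt)) !mulr0 subrr.
Qed.

Lemma coef_reverse n p i : (i <= n)%N -> (reverse n p)`_i = p`_(n - i).
Proof. by move=> le; rewrite coef_poly ltnS le. Qed.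

Lemma reverse_comb n p q a b :
  a *: reverse n p - b *: reverse n q = reverse n (a *: p - b *: q).
Proof.
by apply/polyP=> i; rewrite !coefE; case: ifP => _; rewrite ?mulr0 ?subr0.
Qed.

Lemma reverse_eq0 n p : (size p <= n.+1)%N -> (reverse n p == 0) = (p == 0).
Proof.
move=> sp; apply/eqP/eqP=> [H|->]; last first.
  by apply/polyP=> i; rewrite !coefE; case: ifP.
apply/polyP=> i; rewrite coef0; have [le|lt] := leqP i n; last first.
  by rewrite nth_default // (leq_trans sp).
by rewrite -(subKn le) -coef_reverse ?leq_subr // H coef0.
Qed.

Lemma dvdXn_coef m p : reflect (forall i, (i < m)%N -> p`_i = 0) ('X^m %| p).
Proof.
apply: (iffP idP) => [/dvdpP [q ->] i lt|H].
  by rewrite coefMXn lt.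
rewrite -(poly_take_drop m p) dvdp_addl ?dvdp_mulIr //.
suff -> : take_poly m p = 0 by rewrite dvdp0.
by apply/polyP=> i; rewrite coef_take_poly coef0; case: ifP => // /H.
Qed.

Lemma pencil_neq0 f s t : wronskian f != 0 -> (s != 0) || (t != 0) ->
  t *: num f - s *: den f != 0.
Proof.
move=> W0 /(pencil_basis (num f) (den f)) [y [c c0 [_ EW _ _]]].
apply: contra_neq W0 => u0; rewrite wronskianE; apply/eqP.
rewrite -(inj_eq (scalerI c0)) -EW u0 /wr deriv0 mulr0 mul0r.
by rewrite subrr scaler0.
Qed.

Lemma ram_indexE f x m : wronskian f != 0 ->
  (m <= ram_index f (Some x))%N =
  (('X - x%:P) ^+ m %| (den f).[x] *: num f - (num f).[x] *: den f).
Proof.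
by move=> W0; rewrite /= /ram_index_at mup_geq // pencil_neq0 ?horner_coprime
  ?num_den_coprime.
Qed.

(** Reversal turns vanishing to order [m] at 0 into a drop of the degree by [m]. For [m] above the
    degree plus one, the subtraction truncates to 0 and both sides are false because [u] is
    nonzero. *)
Lemma ram_index_infty f m : wronskian f != 0 ->
  (m <= ram_index f None)%N =
  (size (((den f)`_(degree f) *: num f - (num f)`_(degree f) *: den f)%R)
     <= (degree f).+1 - m)%N.
Proof.
set u := _ - _ => W0.
have u0 : u != 0 by rewrite pencil_neq0 ?degree_coef.
have su : (size u <= (degree f).+1)%N.
  rewrite (leq_trans (size_polyD _ _)) // geq_max size_polyN.
  by rewrite !(leq_trans (size_scale_leq _ _)) ?size_num ?size_den.
rewrite /ram_index /ram_index_at !horner_coef0 !coef_reverse // subn0.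
rewrite reverse_comb -/u mup_geq ?reverse_eq0 // polyC0 subr0.
apply/dvdXn_coef/leq_sizeP => H i lt.
  have [le|lt'] := leqP i (degree f); last first.
    by rewrite nth_default // (leq_trans su).
  by rewrite -(subKn le) -coef_reverse ?leq_subr // H //; lia.
rewrite coef_poly; case: ifP => // le; apply: H; lia.
Qed.

Lemma coefM_top p q m n : (size p <= m.+1)%N -> (size q <= n.+1)%N ->
  (p * q)`_(m + n) = p`_m * q`_n.
Proof.
move=> sp sq; rewrite coefM.
have mlt : (m < (m + n).+1)%N by rewrite ltnS leq_addr.
rewrite (bigD1 (Ordinal mlt)) //= addKn big1 ?addr0 // => i ne.
have [lt|le] := ltnP i m.
  by rewrite (nth_default _ (leq_trans sq _)) ?mulr0 //; lia.
rewrite (nth_default _ (leq_trans sp _)) ?mul0r //.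
by rewrite ltn_neqAle le andbT; apply: contra ne => /eqP E; apply/eqP/val_inj.
Qed.

(** The operator [p -> X p'] multiplies the [i]-th coefficient by [i]; the extra factor ['X] avoids
    the index [m + n - 1]. *)
Lemma coef_XwrX u y m n : (size y <= m.+1)%N -> (size u <= n.+1)%N ->
  (wr y u * 'X)`_(m + n) = y`_m * u`_n * (n%:R - m%:R).
Proof.
have dX p i : (p^`() * 'X)`_i = p`_i *+ i.
  by rewrite coefMX; case: i => [|i] //=; rewrite coef_deriv.
have sX p i : (size p <= i)%N -> (size (p^`() * 'X)%R <= i)%N.
  by move/leq_sizeP=> s; apply/leq_sizeP=> j /s; rewrite dX => ->; rewrite mul0rn.
move=> sy su; rewrite /wr mulrBl -!mulrA coefB coefM_top ?sX //.
rewrite [(m + n)%N]addnC coefM_top ?sX // !dX mulrBr !mulr_natr.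
by rewrite mulrBr !mulrnAr [u`_n * _]mulrC.
Qed.

Lemma size_pencil_infty f : wronskian f != 0 ->
  (0 < size ((den f)`_(degree f) *: num f - (num f)`_(degree f) *: den f)%R
     <= degree f)%N.
Proof.
move=> W0; rewrite size_poly_gt0 pencil_neq0 ?degree_coef //.
by rewrite size_pencil ?size_num ?size_den.
Qed.

(** If [y] completes [u] to a basis, [y] has degree exactly [degree f], and the product of the
    leading terms survives in the Wronskian as long as the two degrees differ in [F]. *)
Lemma size_wronskian_ge f (u : {poly F} :=
    (den f)`_(degree f) *: num f - (num f)`_(degree f) *: den f) :
  wronskian f != 0 -> (size u).-1%:R - (degree f)%:R != 0 :> F ->
  (degree f + (size u).-1 <= size (wronskian f))%N.
Proof.
move=> W0 ne; have /andP [u1 su] := size_pencil_infty W0.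
have [y [c c0 [Ey EW _ _]]] := pencil_basis (num f) (den f) (degree_coef f).
have sy : (size y <= (degree f).+1)%N.
  by case: Ey => [] [-> _]; rewrite ?size_num ?size_den.
have yd : y`_(degree f) = c by case: Ey => [] [-> ->].
have C : (wr y u * 'X)`_(degree f + (size u).-1) != 0.
  by rewrite coef_XwrX ?prednK // yd !mulf_neq0 ?lead_coef_eq0 -?size_poly_gt0.
have : (degree f + (size u).-1 < size (wr y u * 'X)%R)%N.
  by rewrite ltnNge; apply: contra C => le; rewrite nth_default.
by rewrite EW -scalerAl size_scale // size_mulX // ltnS.
Qed.

(** This is [dvdp_wr_lift] from order 1 to order 2, where the integer to invert is 1; hence it holds
    in every characteristic. *)
Lemma root_wronskian_ramified f x : wronskian f != 0 ->
  root (wronskian f) x -> ramified f (Some x).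
Proof.
move=> W0; rewrite -dvdp_XsubCl /ramified ram_indexE // => H.
have [y [c c0 [Ey EW _ _]]] :=
  pencil_basis (num f) (den f) (horner_coprime x (num_den_coprime f)).
have yx : y.[x] = c by case: Ey => [] [-> ->].
apply: (@dvdp_wr_lift _ 0 y); rewrite ?oner_eq0 ?yx //.
  by rewrite expr1 dvdp_XsubCl /root !hornerE mulrC subrr.
by rewrite EW dvdpZr // expr1.
Qed.

Lemma ram_index_wronskian f x m : wronskian f != 0 ->
  (m < ram_index f (Some x))%N -> ('X - x%:P) ^+ m %| wronskian f.
Proof.
move=> W0; rewrite ram_indexE // => H.
have [y [c c0 [_ EW _ _]]] :=
  pencil_basis (num f) (den f) (horner_coprime x (num_den_coprime f)).
by rewrite -(dvdpZr _ _ c0) wronskianE -EW dvdp_wr.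
Qed.

End Wronskian.

(** * Equivalence as equality of pencils *)

Section Equivalence.

Variable F : fieldType.
Implicit Types (p q : {poly F}) (f : ratfun F) (a b c d : F).

Lemma coprimep_comb p q a b c d : a * d - b * c != 0 -> coprimep p q ->
  coprimep (a *: p + b *: q) (c *: p + d *: q).
Proof.
move=> D0 /coprimepP cpq; apply/coprimepP=> e eN eD; apply: cpq.
  rewrite -(dvdpZr _ _ D0).
  have -> : (a * d - b * c) *: p =
      d *: (a *: p + b *: q) - b *: (c *: p + d *: q).
    by rewrite -!mul_polyC polyCB !polyCM; ring.
  by rewrite dvdp_sub // -mul_polyC dvdp_mull.
rewrite -(dvdpZr _ _ D0).
have -> : (a * d - b * c) *: q =
    a *: (c *: p + d *: q) - c *: (a *: p + b *: q).
  by rewrite -!mul_polyC polyCB !polyCM; ring.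
by rewrite dvdp_sub // -mul_polyC dvdp_mull.
Qed.

(** Both sides of the cleared identity come from coprime pairs, so the two denominators divide each
    other and the pairs differ by a scalar, which is absorbed in the matrix. *)
Lemma equivalentP f1 f2 : equivalent f1 f2 <->
  exists a b c d, [/\ a * d - b * c != 0,
    num f2 = a *: num f1 + b *: den f1 & den f2 = c *: num f1 + d *: den f1].
Proof.
split=> [[a [b [c [d [D0 E]]]]]|[a [b [c [d [D0 En Ed]]]]]]; last first.
  by exists a, b, c, d; split=> //; rewrite En Ed mulrC.
have cND := coprimep_comb D0 (num_den_coprime f1).
set N := a *: _ + _ in E cND *; set D := c *: _ + _ in E cND *.
have d2D : den f2 %| D.
  rewrite -(@Gauss_dvdpr _ _ (num f2)) ?E ?dvdp_mulIl // coprimep_sym.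
  exact: num_den_coprime.
have Dd2 : D %| den f2.
  by rewrite -(@Gauss_dvdpl _ _ N) -?E ?dvdp_mulIr // coprimep_sym.
have /eqpP [[r s] /= /andP [r0 s0] rs] : den f2 %= D by rewrite /eqp d2D.
have ED : den f2 = (s / r) *: D.
  by rewrite mulrC -scalerA -rs scalerA mulVf // scale1r.
have t0 : s / r != 0 by rewrite mulf_neq0 ?invr_eq0.
have Dn0 : D != 0.
  by apply: contraNneq (den_neq0 f2) => D_0; rewrite ED D_0 scaler0.
have EN : num f2 = (s / r) *: N.
  by apply: (mulIf Dn0); rewrite E ED -!scalerAl [D * N]mulrC.
exists ((s / r) * a), ((s / r) * b), ((s / r) * c), ((s / r) * d); split.
- set t := s / r in t0 *; have -> : t * a * (t * d) - t * b * (t * c) =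
    t ^+ 2 * (a * d - b * c) by ring.
  by rewrite mulf_neq0 ?expf_neq0.
- by rewrite EN scalerDr !scalerA.
- by rewrite ED scalerDr !scalerA.
Qed.

Lemma wr_free (g h : {poly F}) a b : wr h g != 0 -> a *: g + b *: h = 0 ->
  a = 0 /\ b = 0.
Proof.
move=> W0 E; split.
  have /eqP : wr h (b *: h + a *: g) = 0.
    by rewrite addrC E /wr deriv0 mulr0 mul0r subrr.
  by rewrite wr_combr scaler_eq0 (negbTE W0) orbF => /eqP.
have /eqP : wr (a *: g + b *: h) g = 0 by rewrite E /wr deriv0 mulr0 mul0r subrr.
by rewrite wr_combl scaler_eq0 (negbTE W0) orbF => /eqP.
Qed.

End Equivalence.

(** * Characteristic 3, simple ramification *)

Section CharacteristicThree.

Variable F : fieldType.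
Hypothesis char3 : 3%N \in [pchar F].
Implicit Types (p q u y : {poly F}).

Let three0 : 3%:R = 0 :> {poly F}.
Proof. by rewrite -polyC_natr (pcharf0 char3). Qed.

Let two0 : 2%:R != 0 :> F.
Proof. by rewrite -(dvdn_pcharf char3). Qed.

Lemma deriv3_eq0 p : p^`()^`()^`() = 0.
Proof.
(* The third derivative is [3!] times a divided derivative. *)
have := nderivn_def 3 p; rewrite /derivn /= => ->.
by rewrite (_ : 3`! = (3 * 2)%N) // mulrnA -[_ *+ 3]mulr_natr three0 mulr0 mul0rn.
Qed.

(* In characteristic 3 the derivative W / p^2 of q / p has zero second
   derivative; multiplying by the constant p^3, this reads (W p)'' = 0, a
   linear condition on p which only involves W. *)
Lemma wr_ode p q : (wr p q * p)^`()^`() = 0.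
Proof.
have := deriv3_eq0 p; have := deriv3_eq0 q.
rewrite /wr !(derivM, derivB, derivD) => -> ->.
transitivity (3%:R * (p^`() * (p * q^`()^`() - q * p^`()^`())));
  last by rewrite three0 mul0r.
ring.
Qed.

(** For two solutions [z], [y], the Wronskian [P = wr z y] satisfies [P' W = W' P]. As [W] is prime
    to [W'], it divides [P]; the quotient has zero derivative and degree at most 2, so it is
    constant. *)
Lemma pencil_of_ode (g h y : {poly F}) n :
  coprimep (wr h g) (wr h g)^`() -> (n.*2 <= size (wr h g) + 2)%N ->
  (size g <= n.+1)%N -> (size h <= n.+1)%N -> (size y <= n.+1)%N ->
  wr h g != 0 -> (wr h g * y)^`()^`() = 0 -> exists a b, y = a *: g + b *: h.
Proof.
move=> cW sW sg sh sy W0 Hy.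
have Hg : (wr h g * g)^`()^`() = 0.
  have -> : wr h g * g = - (wr g h * g) by rewrite /wr; ring.
  by rewrite !derivN wr_ode oppr0.
have Hh := wr_ode h g.
set W := wr h g in cW sW W0 Hy Hg Hh.
have key z : (W * z)^`()^`() = 0 -> (size z <= n.+1)%N ->
    exists a, wr z y = a *: W.
  move=> Hz sz; set P := wr z y.
  have EP : P^`() * W = W^`() * P.
    apply/eqP; rewrite -subr_eq0; apply/eqP.
    have : z * (W * y)^`()^`() - y * (W * z)^`()^`()
       = P^`() * W - W^`() * P + 3%:R * (W^`() * P).
      by rewrite /P /wr !(derivM, derivB, derivD); ring.
    by rewrite Hy Hz three0 !mulr0 mul0r subrr addr0 => /esym.
  have /dvdpP [c Ec] : W %| P.
    by rewrite -(Gauss_dvdpr _ cW) -EP dvdp_mulIr.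
  have c'0 : c^`() = 0.
    have : c^`() * (W * W) = P^`() * W - W^`() * P.
      by rewrite Ec !derivM; ring.
    rewrite EP subrr => /eqP; rewrite !mulf_eq0 (negbTE W0) !orbF.
    by move/eqP.
  have sc : (size c <= 3)%N.
    have [->|c0] := eqVneq c 0; first by rewrite size_poly0.
    have sP : (size P <= n.*2)%N.
      have H (p q : {poly F}) : (size p <= n.+1)%N -> (size q <= n.+1)%N ->
          (size (p * q^`())%R <= n.*2)%N.
        move=> sp sq; apply: leq_trans (size_polyMleq _ _) _.
        have : (size q^`() <= n)%N.
          apply/leq_sizeP=> j le.
          by rewrite coef_deriv nth_default ?mul0rn // (leq_trans sq).
        by lia.
      rewrite (leq_trans (size_polyD _ _)) // geq_max size_polyN.
      by rewrite !H.
    have A i j : (0 < i -> 0 < j -> n.*2 <= j + 2 -> (i + j).-1 <= n.*2 ->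
      i <= 3)%N by lia.
    move: sP; rewrite Ec size_mul //.
    by apply: (A _ (size W)); rewrite ?size_poly_gt0.
  (* Only exponents divisible by 3 survive [c' = 0], and [c] has degree at most 2. *)
  have Cc : c = (c`_0)%:P.
    apply/polyP=> i; rewrite coefC; case: i => [|[|[|i]]] //=.
    - by have := congr1 (fun p : {poly F} => p`_0) c'0; rewrite coef_deriv coef0.
    - have := congr1 (fun p : {poly F} => p`_1) c'0; rewrite coef_deriv coef0.
      by move/eqP; rewrite -mulr_natr mulf_eq0 (negbTE two0) orbF => /eqP.
    - by rewrite nth_default // (leq_trans sc).
  by exists c`_0; rewrite -mul_polyC -Cc.
have [a Ea] := key _ Hh sh; have [b Eb] := key _ Hg sg.
exists a, (- b); apply: (mulIf W0).
(* This identity expresses [y] through [g] and [h] once both Wronskians with [y] are multiples of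
   [W]. *)
have -> : y * W = g * wr h y - h * wr g y by rewrite /W /wr; ring.
by rewrite Ea Eb -!mul_polyC polyCN; ring.
Qed.

Variables (f : ratfun F).
Hypotheses (sepf : separable f) (simplef : simply_ramified f).

Let W0 : wronskian f != 0. Proof. exact/separableE. Qed.

(** Simple ramification at infinity leaves a degree drop of 1 or 2 for [u], and both are invertible
    in characteristic 3, so [size_wronskian_ge] applies. *)
Lemma simple_size_wronskian : ((degree f).*2 <= size (wronskian f) + 2)%N.
Proof.
have := simplef None; rewrite leqNgt ram_index_infty // -ltnNge => su.
have := size_wronskian_ge W0; have := size_pencil_infty W0.
move: su; set i := size _; move: (degree f) => n.
move=> ge_i /andP [i0 le_i] H.
have [En|En] : n = i.-1.+1 \/ n = i.-1.+2 by lia.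
  have /H : i.-1%:R - n%:R != 0 :> F.
    by rewrite En -natr1 opprD addrA subrr add0r oppr_eq0 oner_eq0.
  by lia.
have /H : i.-1%:R - n%:R != 0 :> F.
  by rewrite En -addn2 natrD opprD addrA subrr add0r oppr_eq0.
by lia.
Qed.

(** A double root would let [dvdp_wr_lift] raise the vanishing order of [u] from 2 to 3, since 2 is
    invertible. *)
Lemma simple_wronskian_sqfree x : ~~ (('X - x%:P) ^+ 2 %| wronskian f).
Proof.
apply/negP=> H.
have /(root_wronskian_ramified W0) : root (wronskian f) x.
  by rewrite -dvdp_XsubCl (dvdp_trans _ H) // expr2 dvdp_mulIl.
rewrite /ramified ram_indexE // => H2.
have := simplef (Some x); rewrite leqNgt ram_indexE // => /negP; apply.
have [y [c c0 [Ey EW _ _]]] :=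
  pencil_basis (num f) (den f) (horner_coprime x (num_den_coprime f)).
have yx : y.[x] = c by case: Ey => [] [-> ->].
apply: (@dvdp_wr_lift _ _ 1 y); rewrite ?yx //.
by rewrite EW dvdpZr.
Qed.

End CharacteristicThree.

(** * Descent of a two-dimensional solution space *)

Section Descent.

Variables (k F : fieldType) (iota : {rmorphism k -> F}).

Local Notation "p ^i" := (map_poly iota p) (at level 2, format "p ^i").

(** Row [i] of [M] holds the coefficients of [(w X^i)'']; the [m] columns are enough to hold every
    coefficient of [(w p)'']. *)
Lemma kermx_ode (w : {poly k}) n m (M : 'M[k]_(n.+1, m)) (p : {poly F}) :
  M = \matrix_(i, j) (w * 'X^i)^`()^`()`_j -> m = (size w + n.+1)%N ->
  (size p <= n.+1)%N ->
  (poly_rV p <= kermx (map_mx iota M))%MS = ((w^i * p)^`()^`() == 0).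
Proof.
move=> -> Em sp; rewrite sub_kermx.
have Ep : p = \sum_(i < n.+1) p`_i *: 'X^i.
  rewrite -poly_def; apply/polyP=> i; rewrite coef_poly.
  by case: ltnP => // le; rewrite nth_default // (leq_trans sp).
have Ec (j : 'I_m) : ((w^i * p)^`()^`())`_j =
   (poly_rV p *m map_mx iota (\matrix_(i < n.+1, j < m) (w * 'X^i)^`()^`()`_j)) 0 j.
  rewrite {1}Ep mulr_sumr !raddf_sum coef_sum mxE /=; apply: eq_bigr => i _.
  rewrite -scalerAr !derivZ coefZ !mxE; congr (_ * _).
  by rewrite -coef_map -!deriv_map rmorphM /= map_polyXn.
apply/eqP/eqP=> [H|H].
  apply/polyP=> j; rewrite coef0; have [lt|le] := ltnP j m.
    by rewrite (Ec (Ordinal lt)) H mxE.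
  have sq (q : {poly F}) b : (size q <= b)%N -> (size q^`() <= b)%N.
    move=> s; apply/leq_sizeP=> i bi.
    by rewrite coef_deriv nth_default ?mul0rn // (leq_trans s) // ltnW.
  rewrite nth_default // (leq_trans _ le) // !sq // Em.
  rewrite (leq_trans (size_polyMleq _ _)) // size_map_poly.
  have A a b : (a <= n.+1 -> (b + a).-1 <= b + n.+1)%N by lia.
  exact: A.
by apply/rowP=> j; rewrite -Ec H coef0 mxE.
Qed.

Lemma sub_col_mx2 (L : fieldType) n (r s v : 'rV[L]_n) :
  (v <= col_mx r s)%MS -> exists a b, v = a *: r + b *: s.
Proof.
case/submxP=> D ->; exists (lsubmx D 0 0), (rsubmx D 0 0).
rewrite -{1}[D]hsubmxK mul_row_col.
by rewrite {1}[lsubmx D]mx11_scalar {1}[rsubmx D]mx11_scalar !mul_scalar_mx.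
Qed.

Lemma row_free_col_mx2 (L : fieldType) n (r s : 'rV[L]_n) :
  (forall a b, a *: r + b *: s = 0 -> a = 0 /\ b = 0) <->
  row_free (col_mx r s).
Proof.
split=> [free|free a b E].
  apply: inj_row_free => v; rewrite -[v]hsubmxK mul_row_col.
  rewrite [lsubmx v]mx11_scalar [rsubmx v]mx11_scalar !mul_scalar_mx.
  by move/free=> [-> ->]; rewrite !raddf0 row_mx0.
have /(row_free_inj free) : row_mx a%:M b%:M *m col_mx r s = 0 *m col_mx r s.
  by rewrite mul_row_col !mul_scalar_mx mul0mx.
rewrite -row_mx0 => /eq_row_mx [].
by move=> /matrixP /(_ 0 0) + /matrixP /(_ 0 0); rewrite !mxE eqxx.
Qed.

(** The rank of a kernel does not change under field extension, so the kernel over [k] has rank 2,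
    and a basis of it over [k] is also a basis of the solutions over [F]. *)
Lemma descent_ode (w : {poly k}) n (g h : {poly F}) :
  (size g <= n.+1)%N -> (size h <= n.+1)%N ->
  (forall a b, a *: g + b *: h = 0 -> a = 0 /\ b = 0) ->
  (w^i * g)^`()^`() = 0 -> (w^i * h)^`()^`() = 0 ->
  (forall y : {poly F}, (size y <= n.+1)%N -> (w^i * y)^`()^`() = 0 ->
     exists a b, y = a *: g + b *: h) ->
  exists g0 h0 : {poly k}, exists a b c d,
    [/\ a * d - b * c != 0, g0^i = a *: g + b *: h & h0^i = c *: g + d *: h].
Proof.
move=> sg sh free Hg Hh Hy.
pose m := (size w + n.+1)%N.
pose M : 'M[k]_(n.+1, m) := \matrix_(i, j) (w * 'X^i)^`()^`()`_j.
have ker p := @kermx_ode w n m M p erefl erefl.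
pose V : 'M[F]_(1 + 1, n.+1) := col_mx (poly_rV g) (poly_rV h).
have rV : row_free V.
  apply/row_free_col_mx2 => a b /(congr1 rVpoly).
  by rewrite linearD !linearZ /= !poly_rV_K // linear0 => /free.
have VK : (V <= kermx (map_mx iota M))%MS.
  by rewrite col_mx_sub !ker // Hg Hh eqxx.
have KV : (kermx (map_mx iota M) <= V)%MS.
  apply/row_subP=> i; set v := row i _.
  have := row_sub i (kermx (map_mx iota M)); rewrite -/v -[v]rVpolyK.
  rewrite ker ?size_poly // => /eqP /Hy [|a [b ->]]; first exact: size_poly.
  rewrite linearD !linearZ /=; apply/submxP; exists (row_mx a%:M b%:M).
  by rewrite mul_row_col !mul_scalar_mx.
have rK : \rank (kermx M) = (1 + 1)%N.
  rewrite -(mxrank_map iota) map_kermx -(eqP rV).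
  by apply/eqmx_rank/andP.
have [U [fU UK]] : exists U : 'M[k]_(1 + 1, n.+1),
    row_free U /\ (U <= kermx M)%MS.
  move: (row_base (kermx M)) (row_base_free (kermx M)) (eq_row_base (kermx M)).
  by rewrite rK => U fU E; exists U; split=> //; rewrite E.
have UV : (map_mx iota U <= V)%MS.
  by apply: submx_trans KV; rewrite -map_kermx map_submx.
have fU' : row_free (map_mx iota U) by rewrite row_free_map.
rewrite -[U]vsubmxK map_col_mx in UV fU'.
move: UV; rewrite col_mx_sub => /andP [].
set u1 := map_mx iota _ in fU' *; set u2 := map_mx iota _ in fU' *.
move=> /sub_col_mx2 [a [b E1]] /sub_col_mx2 [c [d E2]].
have {}fU' := (row_free_col_mx2 u1 u2).2 fU'.
have Er (v : 'rV[k]_n.+1) : (rVpoly v)^i = rVpoly (map_mx iota v).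
  by rewrite map_rVpoly.
exists (rVpoly (usubmx U)), (rVpoly (dsubmx U)), a, b, c, d; split.
(* If the determinant were zero, the cofactors would give linear relations between the independent
   rows [u1] and [u2], forcing the whole matrix to vanish. *)
- apply/eqP=> D0.
  have [d0 /eqP] : d = 0 /\ - b = 0.
    apply: fU'; rewrite E1 E2 !scalerDr !scalerA addrACA -!scalerDl.
    have -> : d * a + - b * c = 0 by rewrite -D0; ring.
    by rewrite mulrC mulNr addrN !scale0r addr0.
  rewrite oppr_eq0 => /eqP b0.
  have [/eqP] : - c = 0 /\ a = 0.
    apply: fU'; rewrite E1 E2 !scalerDr !scalerA addrACA -!scalerDl.
    have -> : - c * b + a * d = 0 by rewrite -D0; ring.
    by rewrite mulrC mulrN addNr !scale0r addr0.
  rewrite oppr_eq0 => /eqP c0 a0.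
  have [/eqP] : 1 = 0 :> F /\ 0 = 0 :> F.
    by apply: fU'; rewrite E1 a0 b0 !scale0r !addr0 scaler0.
  by rewrite oner_eq0.
- by rewrite Er -/u1 E1 linearD !linearZ /= !poly_rV_K.
- by rewrite Er -/u2 E2 linearD !linearZ /= !poly_rV_K.
Qed.

End Descent.

(** * Rational Wronskians over an algebraically closed field *)

Section Closed.

Variables (k : fieldType) (K : closedFieldType) (iota : {rmorphism k -> K}).

Lemma rational_of_basis (f : ratfun K) (g0 h0 : {poly k}) a b c d :
  separable f -> a * d - b * c != 0 ->
  map_poly iota g0 = a *: num f + b *: den f ->
  map_poly iota h0 = c *: num f + d *: den f ->
  equiv_to_rational iota f.
Proof.
move=> /separableE W0 D0 Eg Eh.
have h0n : h0 != 0.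
  apply: contra_neq D0 => h00; move: Eh; rewrite h00 rmorph0 => /esym.
  by case/(wr_free W0)=> -> ->; rewrite !mulr0 subr0.
have c0 : coprimep g0 h0.
  by rewrite -(coprimep_map iota) Eg Eh coprimep_comb ?num_den_coprime.
exists (RatFun h0n c0); apply/equivalentP; exists a, b, c, d.
by split.
Qed.

Lemma closed_sqfree_coprime (W : {poly K}) :
  (forall x, ~~ (('X - x%:P) ^+ 2 %| W)) -> coprimep W W^`().
Proof.
move=> H; apply: Pdiv.ClosedField.root_coprimep => x.
rewrite -dvdp_XsubCl => /dvdpP [q E].
apply: contra (H x); rewrite E derivM derivXsubC mulr1 !hornerE subrr mulr0.
rewrite add0r => qx; rewrite expr2 dvdp_mul2r ?polyXsubC_eq0 //.
by rewrite dvdp_XsubCl.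
Qed.

Lemma closed_rational_roots (W : {poly K}) :
  (forall x, root W x -> exists x0, x = iota x0) ->
  exists W0 c, W = c *: map_poly iota W0.
Proof.
have [r E] := closed_field_poly_normal W.
have [-> _|W0] := eqVneq W 0.
  by exists 0, 0; rewrite scale0r.
move=> H; suff [P EP] : exists P, \prod_(z <- r) ('X - z%:P) = map_poly iota P.
  by exists P, (lead_coef W); rewrite E EP lead_coefZ /= -EP
    (monicP (monic_prod_XsubC _ _ _)) mulr1.
have {}H z : z \in r -> exists x0, z = iota x0.
  move=> zr; apply: H; rewrite E rootZ ?lead_coef_eq0 //.
  by rewrite root_prod_XsubC.
elim: r {E} H => [|z r IH] H.
  by exists 1; rewrite big_nil rmorph1.
have [|P EP] := IH; first by move=> x xr; apply: H; rewrite inE xr orbT.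
have [z0 Ez] := H z (mem_head _ _).
exists (('X - z0%:P) * P).
by rewrite big_cons EP rmorphM /= rmorphB /= map_polyX map_polyC Ez.
Qed.

Lemma simply_ramified_char3 (f : ratfun K) : 3%N \in [pchar k] ->
  separable f -> simply_ramified f -> rational_ramification iota f ->
  equiv_to_rational iota f.
Proof.
rewrite -(fmorph_pchar iota) => char3 sepf simplef ratf.
have Wf0 : wr (den f) (num f) != 0 by exact/separableE.
have [W0 [c EW]] : exists W0 c, wronskian f = c *: map_poly iota W0.
  apply: closed_rational_roots => x /(root_wronskian_ramified Wf0).
  by move=> /ratf [[x0|] //= [->]]; exists x0.
have c0 : c != 0.
  by apply: contra_neq Wf0 => c0; rewrite -wronskianE EW c0 scale0r.
have EW' : map_poly iota W0 = c^-1 *: wronskian f.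
  by rewrite EW scalerA mulVf // scale1r.
(* Rescaling the Wronskian does not change the equation, so it may be taken over [k]. *)
have Hode (p : {poly K}) :
    (wronskian f * p)^`()^`() = 0 <-> (map_poly iota W0 * p)^`()^`() = 0.
  rewrite EW -scalerAl !derivZ; split=> [/eqP|->]; last by rewrite scaler0.
  by rewrite scaler_eq0 (negbTE c0) => /eqP.
have [||a b|||y sy /Hode Hy|g0 [h0 [a [b [a' [b' [D0 Eg Eh]]]]]]] :=
  @descent_ode _ _ iota W0 (degree f) (num f) (den f).
- exact: size_num.
- exact: size_den.
- exact: wr_free.
- apply/Hode; rewrite wronskianE.
  have -> : wr (den f) (num f) * num f = - (wr (num f) (den f) * num f).
    by rewrite /wr; ring.
  by rewrite !derivN wr_ode // oppr0.
- by apply/Hode; rewrite wronskianE wr_ode.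
- apply: (pencil_of_ode char3 _ _ _ _ sy) Hy => //.
  + by apply: closed_sqfree_coprime; apply: simple_wronskian_sqfree.
  + exact: simple_size_wronskian.
  + exact: size_num.
  + exact: size_den.
exact: rational_of_basis sepf D0 Eg Eh.
Qed.

End Closed.
(** * A cubic not defined over a finite field *)

(* A point (l, y) of the conic y^2 = l^2 - l + 1 is determined by the nonzero
   t = 2 y + 2 l - 1, so the conic has too few points to cover all l. *)
Lemma nonsquare_value (k : finFieldType) : 2%:R != 0 :> k -> 3%:R != 0 :> k ->
  exists l : k, forall y, y ^+ 2 != l ^+ 2 - l + 1.
Proof.
move=> two0 three0; apply: contrapT => /forallNP H.
have sq (l : k) : exists y, y ^+ 2 = l ^+ 2 - l + 1.
  by have /existsNP [y /negP] := H l; rewrite negbK => /eqP; exists y.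
(* On the conic, [3 / t = 2 y - 2 l + 1], so [t - 3 / t = 4 l - 2] and [phi] recovers [l]. *)
pose phi (t : k) : k := ((t - 3%:R / t) / 2%:R + 1) / 2%:R.
have : (#|k| <= #|predC1 (0%R : k)|)%N.
  apply: leq_trans (leq_image_card phi _); rewrite -cardsT.
  apply/subset_leq_card/fintype.subsetP => l _; have [y Ey] := sq l.
  pose t := 2%:R * y + 2%:R * l - 1.
  have Et : t * (2%:R * y - 2%:R * l + 1) = 3%:R.
    have -> : t * (2%:R * y - 2%:R * l + 1) =
      4%:R * (y ^+ 2 - (l ^+ 2 - l + 1)) + 3%:R by rewrite /t; ring.
    by rewrite Ey subrr mulr0 add0r.
  have t0 : t != 0 by apply: contraNneq three0 => t0; rewrite -Et t0 mul0r.
  apply/fintype.imageP; exists t; first by rewrite inE.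
  rewrite /phi -Et [t * _]mulrC mulfK // /t.
  by field; rewrite two0.
by rewrite cardC1 leqNgt ltn_predL; case/negP; apply/card_gt0P; exists 0.
Qed.

Section Cubic.

Variables (K : closedFieldType) (l c : K).
Hypotheses (two0 : 2%:R != 0 :> K) (three0 : 3%:R != 0 :> K).
Hypotheses (l0 : l != 0) (l1 : l != 1).
Hypothesis Ec : 3%:R + l * c ^+ 2 + 2%:R * c * (1 + l) = 0.

Let c0 : c != 0.
Proof.
apply: contraNneq three0 => c0; move: Ec.
by rewrite c0 expr0n /= !mulr0 mul0r !addr0 => ->.
Qed.

Definition cubic_num : {poly K} := 'X^3 + (l * c)%:P * 'X^2.
Definition cubic_den : {poly K} := c%:P * 'X + 1.

Lemma coef_cubic_num i :
  cubic_num`_i = (i == 3)%:R + l * c * (i == 2)%:R.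
Proof. by rewrite coefD coefCM !coefXn. Qed.

Lemma coef_cubic_den i : cubic_den`_i = c * (i == 1)%:R + (i == 0)%:R.
Proof. by rewrite coefD coefCM coefX coef1. Qed.

Lemma cubic_den_neq0 : cubic_den != 0.
Proof.
by apply/eqP=> /(congr1 (fun p : {poly K} => p`_0)) /eqP;
  rewrite coef_cubic_den coef0 mulr0 add0r oner_eq0.
Qed.

(** A common root forces [l c^2 = 1]; then [Ec] gives [c (1 + l) = -2], hence [(1 + l)^2 = 4 l],
    that is [l = 1]. *)
Lemma cubic_coprime : coprimep cubic_num cubic_den.
Proof.
rewrite coprimep_sym; apply: Pdiv.ClosedField.root_coprimep => x.
have -> : cubic_num.[x] = x ^+ 2 * (x + l * c).
  by rewrite hornerD hornerCM !hornerXn; ring.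
rewrite /root /cubic_den !hornerE => /eqP E.
have x0 : x != 0.
  apply/eqP=> x0; move: E; rewrite x0 mulr0 add0r => /eqP.
  by rewrite oner_eq0.
rewrite mulf_neq0 ?expf_neq0 //; apply: contraNneq l1 => E2.
have E3 : l * c ^+ 2 = 1.
  have -> : l * c ^+ 2 = (x + l * c) * c - (c * x + 1) + 1 by ring.
  by rewrite E2 E mul0r subrr add0r.
have : (l - 1) ^+ 2 = 0.
  have E4 : 3%:R + 1 + 2%:R * c * (1 + l) = 0 by move: Ec; rewrite E3.
  have E5 : c * (1 + l) = - 2%:R.
    apply: (mulfI two0); rewrite mulrA.
    have -> : 2%:R * c * (1 + l) = (3%:R + 1 + 2%:R * c * (1 + l)) - 4%:R.
      by ring.
    by rewrite E4; ring.
  have -> : (l - 1) ^+ 2 = (1 + l) ^+ 2 * (1 - l * c ^+ 2)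
     + l * ((c * (1 + l)) ^+ 2 - 4%:R) by ring.
  by rewrite E5 E3; ring.
by move/eqP; rewrite expf_eq0 subr_eq0.
Qed.

Definition cubic : ratfun K := RatFun cubic_den_neq0 cubic_coprime.

(** The two sides differ only in the coefficient of [X^2], by exactly the quantity that [Ec] sets to
    zero. *)
Lemma wronskian_cubic :
  wronskian cubic = (2%:R * c)%:P * ('X * ('X - 1) * ('X - l%:P)).
Proof.
rewrite /wronskian /= /cubic_den /cubic_num !derivE.
transitivity ((2%:R * c)%:P * ('X * ('X - 1) * ('X - l%:P)) +
  (3%:R + l * c ^+ 2 + 2%:R * c * (1 + l))%:P * 'X^2); last first.
  by rewrite Ec polyC0 mul0r addr0.
rewrite !(polyCD, polyCM, polyCN, polyC_natr, polyC1).
ring.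
Qed.

Lemma degree_cubic : degree cubic = 3%N.
Proof.
apply: degreeP => /=; last by rewrite coef_cubic_num /= mulr0 addr0 oner_eq0.
  apply/leq_sizeP=> i; rewrite coef_cubic_num.
  by case: i => [|[|[|[|i]]]] //; rewrite mulr0 addr0.
apply/leq_sizeP=> i; rewrite coef_cubic_den.
by case: i => [|[|[|[|i]]]] //; rewrite mulr0 addr0.
Qed.

Let cc0 : 2%:R * c != 0. Proof. by rewrite mulf_neq0. Qed.

Lemma separable_cubic : separable cubic.
Proof.
rewrite separableE -wronskianE wronskian_cubic !mulf_neq0 ?polyC_eq0 //.
- by rewrite polyX_eq0.
- by rewrite -polyC1 polyXsubC_eq0.
- by rewrite polyXsubC_eq0.
Qed.

Let W0 : wronskian cubic != 0. Proof. exact/separableE/separable_cubic. Qed.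

Lemma root_wronskian_cubic x :
  root (wronskian cubic) x -> [\/ x = 0, x = 1 | x = l].
Proof.
rewrite wronskian_cubic !rootM rootC (negbTE cc0) rootX -polyC1 !root_XsubC /=.
by case/orP=> [/orP [] |] /eqP ->; [constructor 1|constructor 2|constructor 3].
Qed.

Lemma simply_ramified_cubic : simply_ramified cubic.
Proof.
case=> [x|]; rewrite leqNgt; apply/negP.
  move/(ram_index_wronskian W0) => /dvdpP [q Eq].
  have rx : root (wronskian cubic) x.
    by rewrite Eq expr2 mulrA rootM root_XsubC eqxx orbT.
  have : (wronskian cubic)^`().[x] = 0.
    by rewrite Eq derivM (deriv_XsubC_exp x 1) expr1 expr2 hornerD !hornerM
      hornerXsubC subrr !mulr0 addr0.
  have -> : (wronskian cubic)^`().[x] =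
      2%:R * c * ((x - 1) * (x - l) + x * (x - l) + x * (x - 1)).
    by rewrite wronskian_cubic !derivE !hornerE; ring.
  move/eqP; apply/negP; rewrite mulf_neq0 //.
  case: (root_wronskian_cubic rx) => ->;
    rewrite ?subrr ?sub0r ?mulr0 ?mul0r ?addr0 ?add0r ?mulf_neq0 //.
  - by rewrite oppr_eq0 oner_eq0.
  - by rewrite oppr_eq0.
  - by rewrite oner_eq0.
  - by rewrite subr_eq0 eq_sym.
  - by rewrite subr_eq0.
(* At infinity the member of smaller degree is [- cubic_den], of degree 1, so the index is 2. *)
rewrite ram_index_infty // degree_cubic /=.
rewrite coef_cubic_num coef_cubic_den /=.
move/leq_sizeP/(_ 1%N isT); rewrite coefB !coefZ coef_cubic_num coef_cubic_den.
rewrite /= !(mulr0, addr0, mul0r) mulr1 mul1r sub0r => /eqP.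
by rewrite oppr_eq0 (negbTE c0).
Qed.

End Cubic.

Lemma exists_nonrational_cubic (k : finFieldType) (K : closedFieldType)
    (iota : {rmorphism k -> K}) :
  (exists2 p : nat, p \in [pchar k] & (3 < p)%N) ->
  exists f : ratfun K,
    [/\ separable f, simply_ramified f, degree f = 3%N,
        rational_ramification iota f & ~ equiv_to_rational iota f].
Proof.
case=> p charp p3.
have nat0 n : (0 < n < p)%N -> n%:R != 0 :> k.
  by move=> /andP [n0 lt]; rewrite -(dvdn_pcharf charp) gtnNdvd.
have two0 : 2%:R != 0 :> k by apply: nat0; lia.
have three0 : 3%:R != 0 :> k by apply: nat0; lia.
have [l Hl] := nonsquare_value two0 three0.
have l0 : l != 0.
  by apply/eqP=> l0; have := Hl 1; rewrite l0 expr1n expr0n /= subr0 add0r eqxx.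
have l1 : l != 1.
  by apply/eqP=> l1; have := Hl 1; rewrite l1 expr1n subrr add0r eqxx.
have [r Er] : exists r : K, r ^+ 2 = iota (l ^+ 2 - l + 1).
  have [r Er] := @solve_monicpoly K 2
    (fun i => if i == 0%N then iota (l ^+ 2 - l + 1) else 0) isT.
  by exists r; rewrite Er !big_ord_recl big_ord0 /= expr0 mulr1 mul0r !addr0.
have il0 : iota l != 0 by rewrite fmorph_eq0.
have il1 : iota l != 1 by rewrite fmorph_eq1.
have i2 : 2%:R != 0 :> K by rewrite -(rmorph_nat iota) fmorph_eq0.
have i3 : 3%:R != 0 :> K by rewrite -(rmorph_nat iota) fmorph_eq0.
(* Multiplied by [l], the equation for [c] reads [(l c + 1 + l)^2 = l^2 - l + 1]. *)
pose c := (r - (1 + iota l)) / iota l.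
have Elc : iota l * c = r - (1 + iota l) by rewrite /c mulrC mulfVK.
have Ec : 3%:R + iota l * c ^+ 2 + 2%:R * c * (1 + iota l) = 0.
  apply: (mulfI il0); rewrite mulr0.
  have -> : iota l * (3%:R + iota l * c ^+ 2 + 2%:R * c * (1 + iota l)) =
    (iota l * c + (1 + iota l)) ^+ 2 - (iota l ^+ 2 - iota l + 1) by ring.
  by rewrite Elc subrK Er rmorphD rmorphB rmorphXn rmorph1 subrr.
exists (cubic i2 il1 Ec); split.
- exact: separable_cubic.
- exact: simply_ramified_cubic.
- exact: degree_cubic.
- case=> [x|] ramx; last by exists None.
  have W0 : wronskian (cubic i2 il1 Ec) != 0.
    by apply/separableE; apply: separable_cubic.
  have := ram_index_wronskian W0 ramx; rewrite expr1 dvdp_XsubCl.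
  case/(root_wronskian_cubic i3)=> ->.
  + by exists (Some 0); rewrite /= rmorph0.
  + by exists (Some 1); rewrite /= rmorph1.
  + by exists (Some l).
case=> f0 /equivalentP [a [b [a' [b' [D0 En Ed]]]]].
(* For a member of the pencil over [k] with [t != 0], the ratio of these two coefficients puts [c]
   in [k]; [b] and [b'] are not both zero. *)
have coefs (q : {poly k}) s t :
    map_poly iota q = s *: cubic_num (iota l) c + t *: cubic_den c ->
    iota q`_0 = t /\ iota q`_1 = t * c.
  move=> Eq; rewrite -!coef_map Eq !coefD !coefZ !coef_cubic_num !coef_cubic_den.
  by rewrite /= !(mulr0, addr0, add0r, mulr1).
have [Eb Ebc] := coefs _ _ _ En; have [Eb' Ebc'] := coefs _ _ _ Ed.
have [c1 Ec1] : exists c1, iota c1 = c.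
  have [b0|b0] := eqVneq b 0; last first.
    by exists ((num f0)`_1 / (num f0)`_0); rewrite fmorph_div Eb Ebc mulrC mulKf.
  have b'0 : b' != 0.
    by apply: contraNneq D0 => b'0; rewrite b0 b'0 mulr0 mul0r subrr.
  by exists ((den f0)`_1 / (den f0)`_0); rewrite fmorph_div Eb' Ebc' mulrC mulKf.
have /eqP [] := Hl (l * c1 + (1 + l)).
apply: (fmorph_inj iota); rewrite -Er rmorphXn !(rmorphD, rmorphM) rmorph1 /=.
by rewrite Ec1 Elc subrK.
Qed.
(** * Deformations with constant Wronskian *)

(** If [s] listed all of [K], the product of the [X - z] plus 1 would have no root. *)
Lemma closed_infinite (K : closedFieldType) : infinite_set [set: K]%classic.
Proof.
move/finite_seqP=> [s Es].
have sP (x : K) : x \in s by have : [set` s]%classic x by rewrite -Es.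
pose P : {poly K} := \prod_(z <- s) ('X - z%:P).
have s0 : (0 < size s)%N by case: s {Es P} sP => // /(_ 0).
have sizeP : size (P + 1) = (size s).+1.
  by rewrite size_polyDl size_prod_XsubC // size_poly1 ltnS.
have /closed_rootP [x] : size (P + 1) != 1%N by rewrite sizeP; case: (size s) s0.
have /eqP Px : root P x by rewrite root_prod_XsubC.
by rewrite /root hornerD Px hornerC add0r oner_eq0.
Qed.

Section Family.

Variables (k : fieldType) (K : closedFieldType) (iota : {rmorphism k -> K}).
Hypothesis proper : exists w : K, forall x, iota x != w.

Local Notation "p ^i" := (map_poly iota p) (at level 2, format "p ^i").

(** Translation by [c w] moves the coset into its complement, so a finite complement would make [K]
    finite. *)
Lemma infinite_outside_coset (b c e : K) : c != 0 ->
  infinite_set [set x : K | x != e /\ forall x0, x <> b + c * iota x0]%classic.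
Proof.
case: proper => w wP c0 fin; set D := (X in finite_set X) in fin.
apply: (@closed_infinite K).
pose U := (D `|` [set e])%classic.
have finU : finite_set U by rewrite finite_setU; split=> //; exact: finite_set1.
have out x : (forall x0, x <> b + c * iota x0) -> U x.
  by move=> H; have [->|ne] := eqVneq x e; [right|left; split].
apply: (@sub_finite_set _ _ (U `|` (fun x => x - c * w) @` U)%classic).
  move=> x _.
  have [[x0 Ex]|/forallNP/out] := pselect (exists x0, x = b + c * iota x0);
    last by left.
  right; exists (x + c * w); last by rewrite addrK.
  apply: out => y E; have /eqP := wP (y - x0); apply.
  apply: (mulfI c0); rewrite rmorphB mulrBr.
  have -> : c * iota y = b + c * iota x0 + c * w - b by rewrite -Ex E; ring.
  by ring.
by rewrite finite_setU; split=> //; exact: finite_image.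
Qed.

Lemma ratio_rational (A B : {poly k}) (M : {poly K}) (r s : K) :
  M != 0 -> s != 0 -> A^i = r *: M -> B^i = s *: M -> exists q, r = iota q * s.
Proof.
move=> M0 s0 EA EB; exists (lead_coef A / lead_coef B).
rewrite fmorph_div -!lead_coef_map EA EB !lead_coefZ.
have lM : lead_coef M != 0 by rewrite lead_coef_eq0.
by field; rewrite s0 lM.
Qed.

(** Clearing the coefficient in the leading degree of [U] eliminates [x]; what remains is
    [T1 = y V1] with [V1] nonzero, and a leading coefficient yields [y]. *)
Lemma coef_rational (T U V : {poly k}) (x y : K) : U != 0 ->
  (forall c, V <> c *: U) -> T^i = x *: U^i + y *: V^i -> exists z, y = iota z.
Proof.
move=> U0 UV ET; have lU0 : lead_coef U != 0 by rewrite lead_coef_eq0.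
pose i := (size U).-1; pose V1 := V - (V`_i / U`_i) *: U.
pose T1 := T - (T`_i / U`_i) *: U.
have iU : iota (lead_coef U) != 0 by rewrite fmorph_eq0.
have V1n0 : V1 != 0 by rewrite subr_eq0; apply/eqP/UV.
have ET1 j : iota T1`_j = y * iota V1`_j.
  have E n := congr1 (fun p : {poly K} => p`_n) ET.
  have {}E n : iota T`_n = x * iota U`_n + y * iota V`_n.
    by have := E n; rewrite coefD !coefZ !coef_map.
  rewrite /T1 /V1 !coefB !coefZ !rmorphB !rmorphM !fmorphV !E /i -/(lead_coef U).
  by field.
have l0 : iota (lead_coef V1) != 0 by rewrite fmorph_eq0 lead_coef_eq0.
exists (T1`_(size V1).-1 / lead_coef V1).
by rewrite fmorph_div ET1 mulfK.
Qed.

Section Deformation.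

(* The functional l, defined over k, singles out u (up to a scalar) in each
   pencil <u, y + x v>. *)
Variables (f : ratfun K) (u y v : {poly K}) (e : K).
Variables (l : {poly K} -> K) (l0 : {poly k} -> k).
Hypotheses (sepf : separable f) (e0 : e != 0).
Hypothesis Wyu : wr y u = e *: wronskian f.
Hypothesis Wvu : wr v u = 0.
Hypothesis vNu : forall c, v <> c *: u.
Hypothesis l_lin : forall a b p q, l (a *: p + b *: q) = a * l p + b * l q.
Hypothesis l_map : forall p, l p^i = iota (l0 p).
Hypotheses (lu : l u = 0) (ly : l y != 0).
Hypothesis liftable :
  forall U s, s != 0 -> U^i = s *: u -> exists V, V^i = s *: v.
Hypothesis generic : forall x, l (y + x *: v) != 0 ->
  exists2 h : ratfun K, num h = u /\ den h = y + x *: v & degree h = degree f.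

Let W0 : wronskian f != 0. Proof. exact/separableE. Qed.

Let u0 : u != 0.
Proof.
apply: contraNneq W0 => u0; move: Wyu.
rewrite u0 /wr deriv0 mulr0 mul0r subrr => /esym/eqP.
by rewrite scaler_eq0 (negbTE e0).
Qed.

Let Wu x : wr (y + x *: v) u = e *: wronskian f.
Proof. by rewrite wrDl wrZl Wvu scaler0 addr0. Qed.

(** In [y + x2 v = c u + d (y + x1 v)], taking Wronskians with [u] gives [d = 1], so [(x2 - x1) v]
    is a multiple of [u]. *)
Lemma deformation_inj x1 x2 (h1 h2 : ratfun K) :
  num h1 = u -> den h1 = y + x1 *: v -> num h2 = u -> den h2 = y + x2 *: v ->
  equivalent h1 h2 -> x1 = x2.
Proof.
move=> n1 d1 n2 d2 /equivalentP [_ [_ [c [d [_ _]]]]].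
rewrite d2 n1 d1 => E.
have d_1 : d = 1.
  have := Wu x2; rewrite E wr_combl Wu scalerA => /eqP.
  rewrite -subr_eq0 -scalerBl scaler_eq0 (negbTE W0) orbF.
  by rewrite -{2}[e]mul1r -mulrBl mulf_eq0 (negbTE e0) orbF subr_eq0 => /eqP.
have {}E : (x2 - x1) *: v = c *: u.
  apply: (addrI (y + x1 *: v)).
  by rewrite -addrA -scalerDl subrKC E d_1 scale1r addrC.
apply/eqP; rewrite eq_sym -subr_eq0; apply: contraT => ne.
exfalso; apply: (vNu (c := (x2 - x1)^-1 * c)).
by rewrite -scalerA -E scalerA mulVf // scale1r.
Qed.

(** The combination of [num f0] and [den f0] killed by [l0] is over [k] and proportional to [u]; [Y]
    is whichever of the two is not a multiple of [u]. *)
Lemma rational_member x (h : ratfun K) :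
  num h = u -> den h = y + x *: v -> l (y + x *: v) != 0 ->
  equiv_to_rational iota h ->
  exists U Y s t c, [/\ s != 0, t != 0, U^i = s *: u &
    Y^i = c *: u + t *: (y + x *: v)].
Proof.
move=> nh dh lz [f0 /equivalentP [a [b [c [d [D0 /=]]]]]].
rewrite nh dh; move: (y + x *: v) lz => z lz En Ed.
have ln : iota (l0 (num f0)) = b * l z by rewrite -l_map En l_lin lu mulr0 add0r.
have ld : iota (l0 (den f0)) = d * l z by rewrite -l_map Ed l_lin lu mulr0 add0r.
pose U := l0 (den f0) *: num f0 - l0 (num f0) *: den f0.
have EU : U^i = (l z * (a * d - b * c)) *: u.
  rewrite rmorphB /= !map_polyZ /= En Ed ln ld -!mul_polyC.
  by rewrite !(polyCM, polyCB); ring.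
have [d0|d0] := eqVneq d 0; last first.
  by exists U, (den f0), (l z * (a * d - b * c)), d, c; split; rewrite ?mulf_neq0.
exists U, (num f0), (l z * (a * d - b * c)), b, a; split; rewrite ?mulf_neq0 //.
by apply: contraNneq D0 => b0; rewrite b0 d0 mulr0 mul0r subrr.
Qed.

(** If no parameter is rational, any coset will do; otherwise all rational parameters are compared
    with a fixed one, [b]. *)
Lemma rational_coset (h : K -> ratfun K) :
  (forall x, l (y + x *: v) != 0 -> num (h x) = u /\ den (h x) = y + x *: v) ->
  exists b c, c != 0 /\ forall x, l (y + x *: v) != 0 ->
    equiv_to_rational iota (h x) -> exists x0, x = b + c * iota x0.
Proof.
move=> hP.
have [[b [gb rb]]|/forallNP none] :=
  pselect (exists b, l (y + b *: v) != 0 /\ equiv_to_rational iota (h b));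
  last first.
  by exists 0, 1; split=> [|x gx rx]; [rewrite oner_eq0|case: (none x)].
have [nb db] := hP b gb.
have [U [Y' [s [t' [c' [s0 t'0 EU EY']]]]]] := rational_member nb db gb rb.
exists b, (s / t'); split=> [|x gx rx]; first by rewrite mulf_neq0 ?invr_eq0.
have [nx dx] := hP x gx.
have [_ [Y [_ [t [c [_ t0 _ EY]]]]]] := rational_member nx dx gx rx.
(* Wronskians with [U] are over [k] and proportional to one fixed polynomial, so [t / t'] lies in
   [k]. *)
have wrE (P : {poly k}) z a r : P^i = a *: u + r *: (y + z *: v) ->
    (wr P U)^i = r *: ((s * e) *: wronskian f).
  move=> EP; rewrite /wr rmorphB !rmorphM /= -!deriv_map EP EU.
  by rewrite -/(wr _ _) wrZ wr_combl Wu !scalerA; congr (_ *: _); ring.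
have M0 : (s * e) *: wronskian f != 0 by rewrite scaler_eq0 negb_or mulf_neq0.
have [q Eq] := ratio_rational M0 t'0 (wrE _ _ _ _ EY) (wrE _ _ _ _ EY').
have q0 : iota q != 0 by apply: contraNneq t0 => q0; rewrite Eq q0 mul0r.
have [V EV] := liftable s0 EU.
(* With [q = t / t'] the multiples of [y] cancel, leaving a combination of [U] and [V] whose
   coefficients must lie in [k]. *)
have ET : (Y - q *: Y')^i =
    ((c - iota q * c') / s) *: U^i + (t * (x - b) / s) *: V^i.
  rewrite EU EV !scalerA !divfK // rmorphB /= map_polyZ /= EY EY' Eq.
  by rewrite -!mul_polyC !(polyCM, polyCB); ring.
have [z Ez] : exists z, t * (x - b) / s = iota z.
  apply: coef_rational ET.
    by rewrite -(map_poly_eq0 iota) EU scaler_eq0 negb_or s0.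
  move=> a /(congr1 (map_poly iota)); rewrite /= map_polyZ /= EV EU => E.
  apply: (vNu (c := iota a)); apply: (scalerI s0).
  by rewrite E scalerA mulrC -scalerA scalerA mulrC -scalerA.
exists (z / q); rewrite fmorph_div -Ez Eq.
by field; rewrite q0 s0 t'0.
Qed.

Lemma infinite_deformation : infinitely_many_non_rational iota f.
Proof.
have [x|h hP] := @choice K (ratfun K) (fun x hx => l (y + x *: v) != 0 ->
    [/\ num hx = u, den hx = y + x *: v & degree hx = degree f]).
  have [gx|gx] := boolP (l (y + x *: v) != 0).
    by have [hx [? ?] ?] := generic gx; exists hx.
  by exists f.
have hP' x : l (y + x *: v) != 0 -> num (h x) = u /\ den (h x) = y + x *: v.
  by case/hP.
have [b [c [c0 ratP]]] := rational_coset hP'.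
(* The excluded value is the zero of [l (y + x v)] in [x]; if [l v = 0] there is none, and the
   division by zero merely excludes 0. *)
pose A : set K :=
  [set x | x != - l y / l v /\ forall x0, x <> b + c * iota x0]%classic.
have good x : A x -> l (y + x *: v) != 0.
  case=> ne _; have := l_lin 1 x y v; rewrite scale1r mul1r => ->.
  have [->|lv] := eqVneq (l v) 0; first by rewrite mulr0 addr0.
  apply: contra ne; rewrite addrC addr_eq0 => /eqP <-.
  by rewrite mulfK.
apply: (@sub_infinite_set _ ((fun x => ratfun_class (h x)) @` A)%classic).
  move=> _ [x Ax <-]; have gx := good x Ax; have [nx dx degx] := hP x gx.
  have Wx : wronskian (h x) = e *: wronskian f by rewrite wronskianE nx dx Wu.
  exists (h x); split; last reflexivity.
  - by apply/separableE; rewrite -wronskianE Wx scaler_eq0 negb_or e0.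
  - by split; [exact: esym|exists e].
  - by case/(ratP x gx) => x0 Ex; case: Ax => _ /(_ x0).
move=> fin; apply: (@infinite_outside_coset b c (- l y / l v) c0).
have inj : {in A &, injective (fun x => ratfun_class (h x))}.
  move=> x1 x2 /set_mem A1 /set_mem A2 E.
  have [n1 d1] := hP' _ (good _ A1); have [n2 d2] := hP' _ (good _ A2).
  apply: (deformation_inj n1 d1 n2 d2).
  have : ratfun_class (h x2) (h x2).
    by apply/equivalentP; exists 1, 0, 0, 1;
      rewrite !scale1r !scale0r addr0 add0r mulr1 mulr0 subr0 oner_eq0.
  by rewrite -E.
by rewrite -/A -(eq_finite_set (inj_card_eq inj)).
Qed.

End Deformation.
End Family.

(** * Ramification of index at least the characteristic *)

Section HighRamification.

Variables (k : fieldType) (K : closedFieldType) (iota : {rmorphism k -> K}).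
Hypothesis proper : exists w : K, forall x, iota x != w.
Variables (f : ratfun K) (p : nat).
Hypotheses (charp : p \in [pchar K]) (sepf : separable f).

Let W0 : wronskian f != 0. Proof. exact/separableE. Qed.

Let p0 : (0 < p)%N. Proof. exact/prime_gt0/(pcharf_prime charp). Qed.

Lemma deriv_frobenius (x : K) : (('X - x%:P) ^+ p)^`() = 0.
Proof.
rewrite -(prednK p0) deriv_XsubC_exp (prednK p0) (pcharf0 charp) polyC0.
exact: mul0r.
Qed.

(** The deformation is applied with evaluation at [a] as functional and [v = u / (X - a)^p], whose
    divisor is over [k] and has zero derivative. *)
Lemma infinite_high_index_finite (a : k) :
  (p <= ram_index f (Some (iota a)))%N -> infinitely_many_non_rational iota f.
Proof.
rewrite ram_indexE // => /dvdpP [v Ev].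
have [y [e e0 [Ey EW Eg Eh]]] :=
  pencil_basis (num f) (den f) (horner_coprime (iota a) (num_den_coprime f)).
have u0 := pencil_neq0 W0 (horner_coprime (iota a) (num_den_coprime f)).
have cuy : coprimep ((den f).[iota a] *: num f - (num f).[iota a] *: den f) y.
  apply: coprimep_pencil (num_den_coprime f) _.
  by case: Ey => [] [Ey <-]; [left|right].
have su : (size ((den f).[iota a] *: num f - (num f).[iota a] *: den f)%R
    <= (degree f).+1)%N.
  rewrite (leq_trans (size_polyD _ _)) // geq_max size_polyN.
  by rewrite !(leq_trans (size_scale_leq _ _)) ?size_num ?size_den.
have ua : ((den f).[iota a] *: num f - (num f).[iota a] *: den f).[iota a] = 0.
  by rewrite !hornerE mulrC subrr.
have ya : y.[iota a] = e by case: Ey => [] [-> ->].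
have sy : (size y <= (degree f).+1)%N.
  by case: Ey => [] [-> _]; rewrite ?size_num ?size_den.
move: Ev EW Eg Eh u0 cuy su ua; set u := _ *: _ - _ *: _.
set E := ('X - (iota a)%:P) ^+ p => Ev EW Eg Eh u0 cuy su ua.
have E0 : E != 0 by rewrite expf_neq0 ?polyXsubC_eq0.
have v0 : v != 0 by apply: contraNneq u0 => v0; rewrite Ev v0 mul0r.
apply: (@infinite_deformation _ _ _ proper f u y v e
  (fun q => q.[iota a]) (fun q => q.[a]) sepf e0 EW) => //.
- by rewrite Ev /wr derivM deriv_frobenius; ring.
- move=> c Ec; have /eqP : v * (1 - c *: E) = 0.
    by rewrite mulrBr mulr1 -scalerAr -Ev -Ec subrr.
  rewrite mulf_eq0 (negbTE v0) /= => /eqP /(congr1 (horner^~ (iota a))) /eqP.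
  rewrite hornerD hornerN hornerZ horner_exp hornerXsubC subrr expr0n.
  by rewrite gtn_eqF // mulr0 subr0 hornerC horner0 oner_eq0.
- by move=> b c q r; rewrite hornerD !hornerZ.
- by move=> q; rewrite horner_map.
- by rewrite ya.
- move=> U s s0 EU; have EE : E = map_poly iota (('X - a%:P) ^+ p).
    by rewrite rmorphXn rmorphB /= map_polyX map_polyC.
  have /dvdpP [V EV] : ('X - a%:P) ^+ p %| U.
    by rewrite -(dvdp_map iota) -EE EU Ev scalerAl dvdp_mulIr.
  exists V; apply: (mulIf E0); rewrite -scalerAl -Ev -EU EV rmorphM /=.
  by rewrite -EE.
move=> x zx; have z0 : y + x *: v != 0.
  by apply: contraNneq zx => ->; rewrite horner0.
(* Modulo [v] the new member is [y], which is prime to [u] and hence to [v]; and it does not vanish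
   at [a], so it is prime to [E]. *)
have cuz : coprimep u (y + x *: v).
  rewrite Ev coprimepMl; apply/andP; split.
    rewrite addrC -mul_polyC coprimep_addl_mul coprimep_sym.
    by apply: (coprimep_dvdl (q := u)); rewrite ?Ev ?dvdp_mulIl // -Ev coprimep_sym.
  by apply: coprimep_expl; rewrite coprimep_sym coprimep_XsubC.
exists (RatFun z0 cuz) => //; apply: degreeP => //=.
  rewrite (leq_trans (size_polyD _ _)) // geq_max sy.
  rewrite (leq_trans (size_scale_leq _ _)) // (leq_trans _ su) //.
  by rewrite dvdp_leq // Ev dvdp_mulIl.
(* If [u] has smaller degree, so has [v]; then [y] must have full degree, as some member of the
   pencil does. *)
have [ud|//] := eqVneq u`_(degree f) 0; rewrite /=.
have su' : (size u <= degree f)%N.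
  apply/leq_sizeP=> j; rewrite leq_eqVlt => /orP [/eqP <- //|lt].
  by rewrite nth_default // (leq_trans su).
have vd : v`_(degree f) = 0.
  by rewrite nth_default // (leq_trans _ su') // dvdp_leq // Ev dvdp_mulIl.
rewrite coefD coefZ vd mulr0 addr0; apply/eqP=> yd.
have := degree_coef f; case: Eg => [e1 [e2 ->]]; case: Eh => [e3 [e4 ->]].
by rewrite !coefD !coefZ ud yd !mulr0 addr0 eqxx.
Qed.

(** Here the functional is the coefficient in degree [degree f], and [v = u X^p] still fits because
    [u] has degree at most [degree f - p]. *)
Lemma infinite_high_index_infty :
  (p <= ram_index f None)%N -> infinitely_many_non_rational iota f.
Proof.
rewrite ram_index_infty // => sup.
have [y [e e0 [Ey EW _ _]]] := pencil_basis (num f) (den f) (degree_coef f).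
have cuy : coprimep ((den f)`_(degree f) *: num f
    - (num f)`_(degree f) *: den f) y.
  apply: coprimep_pencil (num_den_coprime f) _.
  by case: Ey => [] [Ey <-]; [left|right].
have /andP [u1 su] := size_pencil_infty W0.
have yd : y`_(degree f) = e by case: Ey => [] [-> ->].
have sy : (size y <= (degree f).+1)%N.
  by case: Ey => [] [-> _]; rewrite ?size_num ?size_den.
move: EW cuy u1 su sup; set u := _ *: _ - _ *: _.
rewrite size_poly_gt0 => EW cuy u0 su sup.
have dX : ('X^p)^`() = 0 :> {poly K}.
  by have := deriv_frobenius 0; rewrite polyC0 subr0.
apply: (@infinite_deformation _ _ _ proper f u y (u * 'X^p) e
  (fun q => q`_(degree f)) (fun q => q`_(degree f)) sepf e0 EW) => //.
- by rewrite /wr derivM dX; ring.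
- move=> c /(congr1 (fun q : {poly K} => size q)); rewrite size_mulXn //.
  by have := size_scale_leq c u => /[swap] <-; lia.
- by move=> b c q r; rewrite coefD !coefZ.
- by move=> q; rewrite coef_map.
- by rewrite nth_default.
- by rewrite yd.
- move=> U s s0 EU; exists (U * 'X^p).
  by rewrite rmorphM /= map_polyXn EU scalerAl.
move=> x zx; have z0 : y + x *: (u * 'X^p) != 0.
  by apply: contraNneq zx => ->; rewrite coef0.
have cuz : coprimep u (y + x *: (u * 'X^p)).
  by rewrite addrC mulrC scalerAl coprimep_addl_mul.
exists (RatFun z0 cuz) => //; apply: degreeP => /=.
- exact: leqW.
- rewrite (leq_trans (size_polyD _ _)) // geq_max sy.
  rewrite (leq_trans (size_scale_leq _ _)) // size_mulXn //.
  (* Positivity of [i] rules out a truncated subtraction. *)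
  have A i n : (0 < i -> i <= n - p -> p + i <= n)%N by lia.
  by rewrite A ?size_poly_gt0.
- by rewrite zx orbT.
Qed.

End HighRamification.

(** * Existence of ramification and conclusion *)

Lemma exists_ramified (K : closedFieldType) (f : ratfun K) :
  separable f -> (1 < degree f)%N -> exists P, ramified f P.
Proof.
move=> /separableE W0 d1.
have [|/closed_rootP [x /(root_wronskian_ramified W0) rx]] :=
  eqVneq (size (wronskian f)) 1%N; last by exists (Some x).
(* Were infinity unramified, the Wronskian would have size at least [2 d - 1], which exceeds 1 for
   [d > 1]. *)
move=> sW; exists None; rewrite /ramified ram_index_infty // leqNgt.
apply/negP=> su; have := size_wronskian_ge W0.
have := size_pencil_infty W0; rewrite sW; move: su; set i := size _.
move: d1; move: (degree f) => n n1 lt_i /andP [i0 le_i] H.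
have En : n = i.-1.+1 by lia.
have /H : i.-1%:R - n%:R != 0 :> K.
  by rewrite En -natr1 opprD addrA subrr add0r oppr_eq0 oner_eq0.
by lia.
Qed.

Section NotClosed.

Variables (k : fieldType) (K : closedFieldType) (iota : {rmorphism k -> K}).
Hypothesis nclosed : ~ GRing.closed_field_axiom k.

(** Were [iota] surjective, roots of monic polynomials over [k] found in [K] would come from [k]. *)
Lemma not_closed_proper : exists w : K, forall x, iota x != w.
Proof.
apply: contrapT => /forallNP H; apply: nclosed => n P n0.
have [z Ez] := @solve_monicpoly K n (iota \o P) n0.
have /existsNP [x /negP] := H z; rewrite negbK => /eqP Ex.
exists x; apply: (fmorph_inj iota); rewrite rmorphXn Ex Ez rmorph_sum.
by apply: eq_bigr => i _; rewrite rmorphM rmorphXn Ex.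
Qed.

Lemma infinite_high_index (f : ratfun K) p P : p \in [pchar k] ->
  separable f -> rational_ramification iota f -> (p <= ram_index f P)%N ->
  infinitely_many_non_rational iota f.
Proof.
move=> charp sepf ratf pP.
have charpK : p \in [pchar K] by rewrite (fmorph_pchar iota).
have /ratf [[a|] EP] : ramified f P.
  exact: leq_trans (prime_gt1 (pcharf_prime charp)) pP.
  rewrite EP in pP.
  exact: (infinite_high_index_finite not_closed_proper charpK sepf pP).
rewrite EP in pP.
exact: (infinite_high_index_infty not_closed_proper charpK sepf pP).
Qed.

End NotClosed.

Theorem theorem1p2 :
  (forall (k : fieldType) (K : closedFieldType) (iota : {rmorphism k -> K}),
     algebraic_closure iota ->
     3%N \in [pchar k] ->
     forall f : ratfun K,
       separable f -> simply_ramified f -> rational_ramification iota f ->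
       equiv_to_rational iota f)
  /\
  (forall (k : finFieldType) (K : closedFieldType) (iota : {rmorphism k -> K}),
     algebraic_closure iota ->
     (exists2 p : nat, p \in [pchar k] & (3 < p)%N) ->
     exists f : ratfun K,
       [/\ separable f, simply_ramified f, degree f = 3%N,
           rational_ramification iota f & ~ equiv_to_rational iota f])
  /\
  (forall (k : fieldType) (K : closedFieldType) (iota : {rmorphism k -> K}),
     algebraic_closure iota ->
     ~ GRing.closed_field_axiom k ->
     (2%N \in [pchar k] ->
      forall f : ratfun K,
        separable f -> (1 < degree f)%N -> rational_ramification iota f ->
        infinitely_many_non_rational iota f)
     /\
     (3%N \in [pchar k] ->
      forall f : ratfun K,
        separable f -> rational_ramification iota f -> ~ simply_ramified f ->
        infinitely_many_non_rational iota f)).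
Proof.
split; [|split].
- by move=> k K iota _ char3 f; apply: simply_ramified_char3.
- by move=> k K iota _; apply: exists_nonrational_cubic.
move=> k K iota _ nclosed; split=> char f sepf.
  (* In characteristic 2 any ramification has index at least [p]; in characteristic 3 this is the
     failure of simple ramification. *)
  move=> d1 ratf; have [P rP] := exists_ramified sepf d1.
  exact (infinite_high_index nclosed char sepf ratf rP).
move=> ratf nsimple.
have /existsNP [P /negP] := nsimple; rewrite -ltnNge => rP.
exact: (infinite_high_index nclosed char sepf ratf rP).
Qed.
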